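(* Let $\mathcal{C}\subset\mathbb{Q}_+^p$ be a rational cone and let $\prec$ be a monomial order on $\mathbb{N}^p$ such that every element of $\mathbb{N}^p$ is preceded by only finitely many elements. Then the graph $\mathcal{T}$ of $\mathcal{C}$-semigroups rooted in $\mathcal{C}$ is a tree, and its set of vertices is $\mathcal{S}(\mathcal{C})$, the set of all $\mathcal{C}$-semigroups.
   Context: $\mathbb{N}$ is the set of nonnegative integers and $\mathbb{Q}_+$ the set of nonnegative rationals. An affine semigroup is a finitely generated submonoid of $(\mathbb{N}^p,+)$, $p\ge 1$; it has a unique minimal generating set (as a monoid). A rational cone is a set $\mathcal{C}\subset\mathbb{Q}_+^p$ of all nonnegative rational combinations of finitely many vectors of $\mathbb{N}^p$. An affine semigroup $S\subset\mathcal{C}$ is a $\mathcal{C}$-semigroup if $\mathcal{H}(S)=(\mathcal{C}\setminus S)\cap\mathbb{N}^p$ is finite; $\mathcal{S}(\mathcal{C})$ is the set of all $\mathcal{C}$-semigroups. When regarded as a semigroup, $\mathcal{C}$ means $\mathcal{C}\cap\mathbb{N}^p$. A monomial order $\prec$ on $\mathbb{N}^p$ is a total order such that $a\preceq b$ implies $a+c\preceq b+c$ for all $c\in\mathbb{N}^p$, and $0\preceq c$ for all $c\in\mathbb{N}^p$. The Frobenius element $\mathrm{Fb}(S)$ of $S\in\mathcal{S}(\mathcal{C})$ is the maximum of $\mathcal{H}(S)$ with respect to $\prec$; by convention $\mathrm{Fb}(\mathcal{C})=(-1,\ldots,-1)$, considered as preceding all elements of $\mathbb{N}^p$. Effective sons: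 for $S\in\mathcal{S}(\mathcal{C})$ with minimal generating set $\{s_1\prec\cdots\prec s_t\}$, let $s_r\prec\cdots\prec s_t$ be those minimal generators $s$ with $\mathrm{Fb}(S)\prec s$. The semigroups $S\setminus\{s_r\},\ldots,S\setminus\{s_t\}$ are the effective sons of $S$ (they are elements of $\mathcal{S}(\mathcal{C})$); the set of them is denoted $\mathfrak{F}(S)$ (it is empty if there is no such minimal generator). The graph $\mathcal{T}$: put $L_0=\{\mathcal{C}\}$ and $L_i=\bigcup_{S\in L_{i-1}}\mathfrak{F}(S)$ for $i\ge 1$. The vertex set of $\mathcal{T}$ is $\bigcup_{i\ge 0}L_i$, its root is $\mathcal{C}$, and a pair of vertices $(S,S')$ is an edge if and only if $S'$ is an effective son of $S$. *)

(* Defs.v *)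
(* Mathematical Components, with the classical sets of MathComp-Analysis. *)
From mathcomp Require Import all_boot all_order all_algebra.
From mathcomp Require Import all_classical.

Set Implicit Arguments.
Unset Strict Implicit.
Unset Printing Implicit Defensive.

Import Order.TTheory GRing.Theory Num.Theory.

Local Open Scope classical_set_scope.
Local Open Scope ring_scope.

Section AffineSemigroups.
Variable p : nat.
Implicit Types (S A : set 'rV[nat]_p) (C : set 'rV[rat]_p).

Definition submonoid S : Prop :=
  S 0 /\ forall x y, S x -> S y -> S (x + y).

Definition generated A : set 'rV[nat]_p := smallest submonoid A.

Definition affine_semigroup S : Prop :=
  exists2 A, finite_set A & S = generated A.

Definition minimal_generating_set S A : Prop :=
  generated A = S /\ forall B, B `<=` A -> generated B = S -> B = A.

(* An affine semigroup has exactly one minimal generating set, so ranging over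
   all of them is the same as naming it. *)
Definition minimal_generator S (s : 'rV[nat]_p) : Prop :=
  exists2 A, minimal_generating_set S A & A s.

Definition ratvec (x : 'rV[nat]_p) : 'rV[rat]_p :=
  map_mx (fun n : nat => n%:R) x.

Definition rational_cone C : Prop :=
  exists (n : nat) (v : 'I_n -> 'rV[nat]_p),
    C = [set \sum_i a i *: ratvec (v i) |
          a in [set a : 'I_n -> rat | forall i, 0 <= a i]].

Definition lattice_points C : set 'rV[nat]_p := ratvec @^-1` C.

Definition holes C S : set 'rV[nat]_p := lattice_points C `\` S.

Definition C_semigroup C S : Prop :=
  [/\ affine_semigroup S, S `<=` lattice_points C & finite_set (holes C S)].

End AffineSemigroups.

Section SemigroupTree.
Variable p : nat.
Variable le : rel 'rV[nat]_p.
Implicit Types (S : set 'rV[nat]_p) (C : set 'rV[rat]_p).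

Definition monomial_order : Prop :=
  [/\ [/\ reflexive le, antisymmetric le, transitive le & total le],
      forall a b c, le a b -> le (a + c) (b + c)
    & forall c, le 0 c].

Definition precedes (a b : 'rV[nat]_p) : bool := (a != b) && le a b.

Definition minus_ones : 'rV[int]_p := const_mx (-1).

Definition intvec (x : 'rV[nat]_p) : 'rV[int]_p := map_mx Posz x.

(* The default value 0 of [xget] is never used for C-semigroups: a nonempty
   finite set of holes has a maximum. *)
Definition Frobenius C S : 'rV[int]_p :=
  if `[< S = lattice_points C >] then minus_ones
  else intvec (xget 0 [set m | holes C S m /\ forall h, holes C S h -> le h m]).

(* The strict order between a Frobenius element and a vector of N^p: the vector
   (-1, ..., -1) comes before every element of N^p. *)
Definition Fb_precedes (f : 'rV[int]_p) (s : 'rV[nat]_p) : Prop :=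
  f = minus_ones \/ exists2 x, f = intvec x & precedes x s.

Definition effective_sons C S : set (set 'rV[nat]_p) :=
  [set S `\ s |
    s in [set s | minimal_generator S s /\ Fb_precedes (Frobenius C S) s]].

Fixpoint level C (i : nat) : set (set 'rV[nat]_p) :=
  if i is j.+1 then \bigcup_(S in level C j) effective_sons C S
  else [set lattice_points C].

Definition vertices C : set (set 'rV[nat]_p) := \bigcup_i level C i.

Definition edge C : rel (set 'rV[nat]_p) := fun S S' =>
  `[< [/\ vertices C S, vertices C S' & effective_sons C S S'] >].

End SemigroupTree.

(* The directed graph with vertex set V and edges E is a tree rooted in r, its
   edges pointing away from r: every vertex is the end of exactly one walk from
   r. Uniqueness ranges over all walks, so it excludes loops and cycles, through
   r too, and makes the underlying undirected graph a tree. *)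
Definition rooted_tree (T : Type) (V : set T) (E : rel T) (r : T) : Prop :=
  [/\ V r,
      forall x y, E x y -> V x /\ V y
    & forall x, V x -> exists! w : seq T, path E r w /\ last r w = x].

(* Main.v *)
(* Adjoining to a C-semigroup S, other than C itself, its largest hole f gives a
   C-semigroup: f + x, for x nonzero in C, comes strictly after f, so it is not
   a hole. In that semigroup f is a minimal generator beyond all holes, so S is
   one of its effective sons. Conversely, the element removed in an effective
   son is the largest hole of the son, which therefore determines its parent;
   and C, having no holes, is no one's son. As adjoining f removes one hole, the
   root C is reached from every S after finitely many steps. *)
Require Import Defs.
From mathcomp Require Import all_boot all_order all_algebra.
From mathcomp Require Import all_classical.

Set Implicit Arguments.
Unset Strict Implicit.
Unset Printing Implicit Defensive.

Import Order.TTheory GRing.Theory Num.Theory.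

Local Open Scope classical_set_scope.
Local Open Scope ring_scope.

(** * Submonoids of N^p and their irreducible elements *)

Section Submonoids.
Variable p : nat.
Implicit Types (x y z s : 'rV[nat]_p) (S A B M : set 'rV[nat]_p).

Lemma nat_rV_addrI x y z : x + y = x + z -> y = z.
Proof.
move=> /matrixP e; apply/matrixP=> i j; have := e i j.
by rewrite !mxE => /addnI.
Qed.

Lemma nat_rV_addr_eq0 x y : x + y = 0 -> x = 0 /\ y = 0.
Proof.
move=> /matrixP e; split; apply/matrixP=> i j; have := e i j; rewrite !mxE.
  by move/eqP; rewrite addn_eq0 => /andP[/eqP].
by move/eqP; rewrite addn_eq0 => /andP[_ /eqP].
Qed.

Lemma generated_submonoid A : submonoid (generated A).
Proof.
split=> [M [[M0 _] _] //|x y Ax Ay M MA].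
by apply: MA.1.2; [apply: Ax|apply: Ay].
Qed.

Lemma sub_generated A : A `<=` generated A.
Proof. exact: sub_gen_smallest. Qed.

Lemma generated_sub A M : submonoid M -> A `<=` M -> generated A `<=` M.
Proof. exact: smallest_sub. Qed.

Lemma affine_submonoid S : affine_semigroup S -> submonoid S.
Proof. by move=> [A _ ->]; exact: generated_submonoid. Qed.

Lemma submonoid_mulrn M x n : submonoid M -> M x -> M (x *+ n).
Proof.
move=> [M0 MD] Mx; elim: n => [|n IHn]; first by rewrite mulr0n.
by rewrite mulrS; apply: MD.
Qed.

Lemma submonoid_sum M n (F : 'I_n -> 'rV[nat]_p) :
  submonoid M -> (forall i, M (F i)) -> M (\sum_i F i).
Proof. by move=> [M0 MD] MF; apply: big_ind. Qed.

(** For a submonoid [S] these are the atoms: nonzero and not a sum of two nonzero elements of [S].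
    Phrasing this by removal matches the shape of an effective son. *)
Definition irreducibles S : set 'rV[nat]_p :=
  [set s | S s /\ submonoid (S `\ s)].

Definition weight x : nat := (\sum_j x 0%R j)%N.

Lemma weightD x y : weight (x + y) = (weight x + weight y)%N.
Proof. by rewrite /weight -big_split; apply: eq_bigr => j _; rewrite mxE. Qed.

Lemma weight_eq0 x : weight x = 0%N -> x = 0.
Proof.
move=> /eqP; rewrite sum_nat_eq0 => /forallP x0; apply/rowP => j.
by have /eqP := x0 j; rewrite mxE.
Qed.

(** Strong induction on [weight]: a nonzero element that is not irreducible splits into two elements
    of [S], each of smaller weight. *)
Lemma generated_irreducibles S : submonoid S -> generated (irreducibles S) = S.
Proof.
move=> monS; apply/seteqP; split; first by apply: generated_sub => // s [].
have [gen0 genD] := generated_submonoid (irreducibles S).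
move=> x; have [n] := ubnP (weight x); elim: n x => // n IHn x ltxn Sx.
have [->//|xn0] := eqVneq x 0.
have [monSx|] := pselect (submonoid (S `\ x)); first exact: sub_generated.
move=> nmon; have [y [z [Sy Sz yx zx exyz]]] :
    exists y z, [/\ S y, S z, y <> x, z <> x & x = y + z].
  apply: contrapT => nyz; apply: nmon; split.
    by split; [exact: monS.1|move/esym/eqP; apply/negP].
  move=> y z [Sy yx] [Sz zx]; split; first exact: monS.2.
  by move=> eyz; apply: nyz; exists y, z.
(* A zero summand would make the other one equal to [x]. *)
have posw u v : x = u + v -> v <> x -> (0 < weight u)%N.
  move=> exuv vx; rewrite lt0n; apply/eqP => /weight_eq0 u0.
  by apply: vx; rewrite exuv u0 add0r.
have := posw _ _ exyz zx; have := posw z y; rewrite addrC => /(_ exyz yx).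
move: ltxn; rewrite exyz weightD ltnS => le_n z_gt0 y_gt0.
apply: genD; apply: IHn => //; apply: leq_trans le_n.
  by rewrite -addn1 leq_add2l.
by rewrite -add1n leq_add2r.
Qed.

(* An element of the monoid generated by [A] either does without the generator
   [s], or dominates [s] componentwise. *)
Lemma minimal_generator_irreducible S s :
  minimal_generator S s -> irreducibles S s.
Proof.
move=> [A [genA minA] As]; have monS : submonoid S.
  by rewrite -genA; exact: generated_submonoid.
have [gen0 genD] := generated_submonoid (A `\ s).
(* Otherwise [A] without [s] would still generate [S], against minimality. *)
have Nsgen : ~ generated (A `\ s) s.
  move=> gens; have eA : A `\ s = A.
    apply: minA; first by move=> ? [].
    apply/seteqP; split.
      rewrite -genA; apply: generated_sub; first exact: generated_submonoid.
      by move=> x [Ax _]; exact: sub_generated.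
    rewrite -genA; apply: generated_sub; first exact: generated_submonoid.
    move=> x Ax; have [->//|/eqP xs] := eqVneq x s.
    exact: sub_generated.
  by have [_ []] : (A `\ s) s by rewrite eA.
have dec x : S x -> generated (A `\ s) x \/ exists w, x = s + w.
  rewrite -genA; apply: (generated_sub
    (M := [set x | generated (A `\ s) x \/ exists w, x = s + w])).
    split=> [|y z]; first by left.
    move=> [gy|[w ->]]; last by right; exists (w + z); rewrite addrA.
    move=> [gz|[w ->]]; first by left; exact: genD.
    by right; exists (y + w); rewrite addrCA.
  move=> y Ay; have [->|/eqP ys] := eqVneq y s.
    by right; exists 0; rewrite addr0.
  by left; exact: sub_generated.
(* If a summand is [s + w], cancelling [s] forces [w = 0], so that summand is [s]. Otherwise both
   summands lie in the monoid generated without [s], which does not contain [s]. *)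
have Ns_add x y : S x -> S y -> x <> s -> y <> s -> x + y <> s.
  move=> Sx Sy xs ys; have [gx|[w ex]] := dec _ Sx; last first.
    rewrite ex -addrA -[RHS]addr0 => /nat_rV_addrI.
    by move=> /nat_rV_addr_eq0[w0 _]; apply: xs; rewrite ex w0 addr0.
  have [gy|[w ey]] := dec _ Sy.
    by move=> exy; have := genD _ _ gx gy; rewrite exy.
  rewrite ey addrCA -[RHS]addr0 => /nat_rV_addrI.
  by move=> /nat_rV_addr_eq0[_ w0]; apply: ys; rewrite ey w0 addr0.
split; first by rewrite -genA; exact: sub_generated.
split; first by split; [exact: monS.1|move=> s0; apply: Nsgen; rewrite -{2}s0].
move=> x y [Sx xs] [Sy ys]; split; first exact: monS.2.
exact: Ns_add.
Qed.

(** The irreducibles form a minimal generating set: a subset of them missing [x] generates only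
    inside the submonoid [S] minus [x]. *)
Lemma irreducible_minimal_generator S s :
  submonoid S -> irreducibles S s -> minimal_generator S s.
Proof.
move=> monS irr_s; exists (irreducibles S) => //; split.
  exact: generated_irreducibles.
move=> B BI genB; apply/seteqP; split=> // x [Sx monSx]; apply: contrapT => nBx.
have : generated B `<=` S `\ x.
  apply: generated_sub => // y By; split; first by have [] := BI _ By.
  by move=> yx; apply: nBx; rewrite -yx.
by rewrite genB => /(_ _ Sx) [_ []].
Qed.

(** * Affine semigroups under adding or removing one element *)

Lemma affine_semigroupU1 S s :
  affine_semigroup S -> submonoid (s |` S) -> affine_semigroup (s |` S).
Proof.
move=> [A finA ->] mon; exists (s |` A); first by rewrite finite_setU.
apply/seteqP; split.
  move=> x [->|]; first by apply: sub_generated; left.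
  apply: generated_sub; first exact: generated_submonoid.
  by move=> y Ay; apply: sub_generated; right.
apply: generated_sub => // y [->|Ay]; first by left.
by right; exact: sub_generated.
Qed.

(* If [A] generates [S], then [S] without [s] is generated by the multiples
   [2s] and [3s] together with the [a] and [s + a] for [a] in [A] other than
   [0] and [s]. *)
Lemma affine_semigroupD1 S s :
  affine_semigroup S -> irreducibles S s -> affine_semigroup (S `\ s).
Proof.
move=> [A finA eS] [Ss monSs]; have monS : submonoid S.
  by rewrite eS; exact: generated_submonoid.
pose A0 := A `\` [set s; 0].
pose A' := [set s *+ 2; s *+ 3] `|` (A0 `|` [set s + a | a in A0]).
have finA0 : finite_set A0 by exact: finite_setD.
exists A'.
  by rewrite !finite_setU; split=> //; split=> //; apply: finite_image.
have [gen0 genD] := generated_submonoid A'.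
have genA0 a : A0 a -> generated A' a.
  by move=> ?; apply: sub_generated; right; left.
have gensA0 a : A0 a -> generated A' (s + a).
  by move=> ?; apply: sub_generated; right; right; exists a.
have gen2 : generated A' (s *+ 2) by apply: sub_generated; left; left.
have gen3 : generated A' (s *+ 3) by apply: sub_generated; left; right.
have sn0 : s <> 0 by move=> s0; have [[_ []]] := monSs.
(* Makes up for the missing generator [s]. On generators: [s + 2s = 3s], [s + 3s = 2s + 2s] and
   [s + (s + a) = 2s + a]. *)
have shift x : generated A' x -> x = 0 \/ generated A' (s + x).
  suff: generated A' `<=`
      [set x | generated A' x /\ (x = 0 \/ generated A' (s + x))].
    by move=> /[apply] -[].
  apply: generated_sub.
    split=> [|y z [gy hy] [gz hz]]; first by split=> //; left.
    split; first exact: genD.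
    case: hy => [->|gsy]; first by rewrite add0r.
    by right; rewrite addrA; exact: genD.
  move=> {}x [[->|->]|[A0x|[a A0a <-]]].
  - by split=> //; right; rewrite -mulrS.
  - by split=> //; right; rewrite -mulrS (mulrnDr s 2 2); exact: genD.
  - by split; [exact: genA0|right; exact: gensA0].
  - split; first exact: gensA0.
    by right; rewrite addrA -mulr2n; apply: genD => //; exact: genA0.
apply/seteqP; split; last first.
  apply: generated_sub => // x A'x; split.
    case: A'x => [[->|->]|[[Ax _]|[a [Aa _] <-]]].
    - exact: submonoid_mulrn.
    - exact: submonoid_mulrn.
    - by rewrite eS; exact: sub_generated.
    - by apply: monS.2 => //; rewrite eS; exact: sub_generated.
  rewrite /=; case: A'x => [[->|->]|[[_ N]|[a [_ N] <-]]].
  - by rewrite mulr2n -[RHS]addr0 => /nat_rV_addrI.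
  - rewrite mulrS -[RHS]addr0 => /nat_rV_addrI.
    by rewrite mulr2n => /nat_rV_addr_eq0[].
  - by move=> xs; apply: N; left.
  - by rewrite -[RHS]addr0 => /nat_rV_addrI a0; apply: N; right.
(* Allowing [s] itself gives a property closed under addition: [s + s] is the generator [2s], and
   [shift] absorbs a single [s]. *)
move=> x [Sx xs]; suff [//|//] : x = s \/ generated A' x.
have : generated A x by rewrite -eS.
apply: (generated_sub (M := [set x | x = s \/ generated A' x])).
  split=> [|y z]; first by right.
  move=> [->|gy] [->|gz]; [by right; rewrite -mulr2n|..].
  - by case: (shift z gz) => [->|]; [left; rewrite addr0|right].
  - by rewrite addrC; case: (shift y gy) => [->|]; [left; rewrite addr0|right].
  - by right; exact: genD.
move=> a Aa; have [[as_|->]|N] := pselect ([set s; 0] a); [by left|by right|].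
by right; apply: genA0.
Qed.

End Submonoids.

(** * Lattice points of a rational cone *)

Section LatticePoints.
Variable p : nat.
Implicit Types (x y : 'rV[nat]_p) (C : set 'rV[rat]_p).

Lemma ratvec0 : ratvec (0 : 'rV[nat]_p) = 0.
Proof. by apply/rowP => j; rewrite !mxE. Qed.

Lemma ratvecD x y : ratvec (x + y) = ratvec x + ratvec y.
Proof. by apply/rowP => j; rewrite !mxE natrD. Qed.

Lemma lattice_points_submonoid C :
  rational_cone C -> submonoid (lattice_points C).
Proof.
move=> [n [v ->]]; split.
  by exists (fun=> 0) => //; rewrite ratvec0 big1 // => i _; rewrite scale0r.
move=> x y [a a0 ea] [b b0 eb]; exists (fun i => a i + b i).
  by move=> i; exact: addr_ge0.
rewrite ratvecD -ea -eb -big_split; apply: eq_bigr => i _.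
by rewrite scalerDl.
Qed.

Lemma finite_bounded_rV (b : nat) :
  finite_set [set x : 'rV[nat]_p | forall j, (x 0%R j <= b)%N].
Proof.
pose f (y : 'rV['I_b.+1]_p) : 'rV[nat]_p := map_mx val y.
apply: (sub_finite_set (B := f @` setT)); last first.
  by apply: finite_image; exact: finite_finset.
move=> x xb; exists (\row_j inord (x 0 j)) => //.
by apply/rowP => j; rewrite !mxE /= inordK // ltnS.
Qed.

(* Gordan's lemma: splitting off the integral parts of the coefficients leaves
   a lattice point in the zonotope spanned by the [v i]. *)
Lemma lattice_points_affine C :
  rational_cone C -> affine_semigroup (lattice_points C).
Proof.
move=> coneC; have monC := lattice_points_submonoid coneC.
case: coneC => n [v eC].
(* Bounds every coordinate of each [v i] and of each combination of the [v i] with coefficients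
   between 0 and 1. *)
pose b := (\sum_i \sum_j v i 0%R j)%N.
pose A := [set x | lattice_points C x /\ forall j, (x 0%R j <= b)%N].
exists A.
  by apply: sub_finite_set (finite_bounded_rV b) => x [].
apply/seteqP; split; last by apply: generated_sub => // x [].
have Av i : A (v i).
  split.
    rewrite /lattice_points /preimage/= eC; exists (fun j => (j == i)%:R).
      by move=> j; rewrite ler0n.
    rewrite (bigD1 i) //= eqxx scale1r big1 ?addr0 // => j /negPf ->.
    by rewrite scale0r.
  move=> j; rewrite /b (bigD1 i) //= (bigD1 j) //= -addnA; exact: leq_addr.
move=> x; rewrite /lattice_points /preimage/= eC => -[a a0 ea].
pose k i := Num.truncn (a i).
pose w := \sum_i v i *+ k i.
have exj j : (x 0 j)%:R = \sum_i a i * (v i 0 j)%:R :> rat.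
  have := congr1 (fun y : 'rV[rat]_p => y 0 j) ea; rewrite !mxE summxE => <-.
  by apply: eq_bigr => i _; rewrite !mxE.
have ewj j : (w 0 j)%:R = \sum_i (k i)%:R * (v i 0 j)%:R :> rat.
  rewrite summxE natr_sum; apply: eq_bigr => i _.
  by rewrite mulmxnE -[v i 0 j *+ k i]mulr_natl natn natrM.
have k_le i : (k i)%:R <= a i by rewrite Num.Theory.truncn_le; exact: a0.
(* Makes the truncated subtraction that defines [y] exact. *)
have lewx j : (w 0%R j <= x 0%R j)%N.
  rewrite -(ler_nat rat) exj ewj; apply: ler_sum => i _.
  by apply: ler_wpM2r.
pose y : 'rV[nat]_p := \row_j (x 0%R j - w 0%R j)%N.
have exy : x = y + w by apply/rowP => j; rewrite !mxE natrDE subnK.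
have eyj j : (y 0 j)%:R = \sum_i (a i - (k i)%:R) * (v i 0 j)%:R :> rat.
  rewrite mxE natrB // exj ewj -sumrB; apply: eq_bigr => i _.
  by rewrite mulrBl.
have [_ genD] := generated_submonoid A; rewrite exy; apply: genD; last first.
  apply: submonoid_sum; first exact: generated_submonoid.
  move=> i; have gv := sub_generated (Av i).
  exact: (submonoid_mulrn _ (generated_submonoid A) gv).
apply: sub_generated; split.
  rewrite /lattice_points /preimage/= eC; exists (fun i => a i - (k i)%:R).
    by move=> i; rewrite subr_ge0.
  apply/rowP => j; rewrite summxE [RHS]mxE eyj; apply: eq_bigr => i _.
  by rewrite !mxE.
(* The fractional parts [a i - k i] are less than 1. *)
move=> j; apply: (@leq_trans (\sum_i v i 0%R j)%N).
  rewrite -(ler_nat rat) eyj natr_sum; apply: ler_sum => i _.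
  rewrite -[leRHS]mul1r ler_wpM2r // lerBlDl natr1.
  by apply: ltW; exact: Num.Theory.truncnS_gt.
by apply: leq_sum => i _; rewrite (bigD1 j) //=; exact: leq_addr.
Qed.

End LatticePoints.

(** * Largest holes and the Frobenius element *)

Section Frobenius.
Variable p : nat.
Hypothesis p_gt0 : (0 < p)%N.
Variable C : set 'rV[rat]_p.
Hypothesis coneC : rational_cone C.
Variable le : rel 'rV[nat]_p.
Hypothesis le_monomial : monomial_order le.
Implicit Types (x y f s : 'rV[nat]_p) (S : set 'rV[nat]_p).

Lemma intvec_inj : injective (@intvec p).
Proof.
by move=> x y /rowP e; apply/rowP => j; have := e j; rewrite !mxE => -[].
Qed.

(* For [p = 0] the vector (-1, ..., -1) is empty and equal to [intvec 0]. *)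
Lemma intvec_neq_minus_ones x : intvec x <> minus_ones p.
Proof. by move=> /rowP/(_ (Ordinal p_gt0)); rewrite !mxE. Qed.

Lemma precedes_le x y : precedes le x y -> le x y.
Proof. by move=> /andP[]. Qed.

(** The Frobenius element as a vector of N^p, given as a relation so that neither the choice
    operator nor the convention for the full cone interferes. *)
Definition max_hole S f : Prop :=
  holes C S f /\ forall h, holes C S h -> le h f.

Lemma max_hole_unique S f g : max_hole S f -> max_hole S g -> f = g.
Proof.
move=> [hf mf] [hg mg]; case: le_monomial => -[_ anti _ _] _ _.
by apply: anti; rewrite mg ?mf.
Qed.

Lemma seq_max (s : seq 'rV[nat]_p) x :
  exists2 m, m \in x :: s & forall h, h \in x :: s -> le h m.
Proof.
case: le_monomial => -[refl _ trans tot] _ _.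
elim: s x => [|y s IHs] x.
  by exists x; rewrite ?mem_head // => h; rewrite inE => /eqP ->.
have [m ms mmax] := IHs y; have [lexm|lemx] := orP (tot x m).
  exists m; first by rewrite inE ms orbT.
  by move=> h; rewrite inE => /orP[/eqP ->//|]; exact: mmax.
exists x; first exact: mem_head.
move=> h; rewrite inE => /orP[/eqP ->//|hs].
by apply: trans lemx; exact: mmax.
Qed.

Lemma holes_eq0 S : S `<=` lattice_points C -> holes C S = set0 ->
  S = lattice_points C.
Proof.
by move=> SC h0; apply/seteqP; split=> //; rewrite -setD_eq0.
Qed.

Lemma max_hole_exists S : C_semigroup C S -> S <> lattice_points C ->
  exists f, max_hole S f.
Proof.
move=> [_ SC /finite_seqP[[|x s] es]] SnC.
  by case: SnC; apply: holes_eq0 => //; rewrite es set_nil.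
have [m ms mmax] := seq_max s x.
by exists m; split=> [|h]; rewrite es //; exact: mmax.
Qed.

Lemma FrobeniusE S f : max_hole S f -> Frobenius le C S = intvec f.
Proof.
move=> maxf; rewrite /Frobenius; case: asboolP => [e|_].
  by case: maxf => -[Cf]; rewrite e.
congr intvec; apply: (max_hole_unique (S := S)) => //.
by apply: (xgetPex 0 (P := [set m | max_hole S m])); exists f.
Qed.

Lemma Fb_precedesE S f s : max_hole S f ->
  Fb_precedes le (Frobenius le C S) s <-> precedes le f s.
Proof.
move=> maxf; rewrite (FrobeniusE maxf); split.
  by move=> [/intvec_neq_minus_ones//|[x /intvec_inj ->]].
by move=> fs; right; exists f.
Qed.

Lemma holesD1 S s : S s -> S `<=` lattice_points C ->
  holes C (S `\ s) = s |` holes C S.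
Proof.
move=> Ss SC; apply/seteqP; split=> x.
  move=> [Cx NSx]; have [->|/eqP xs] := eqVneq x s; first by left.
  by right; split=> // Sx; apply: NSx.
move=> [->|[Cx NSx]]; first by split; [exact: SC|move=> [_ []]].
by split=> // -[].
Qed.

(** * Effective sons and their parents *)

Lemma effective_son_C_semigroup S S' :
  C_semigroup C S -> effective_sons le C S S' -> C_semigroup C S'.
Proof.
move=> [affS SC finS] [s [gen_s _] <-].
have irr_s := minimal_generator_irreducible gen_s; have [Ss _] := irr_s.
split; [exact: affine_semigroupD1|by move=> x [/SC]|].
by rewrite holesD1 // finite_setU.
Qed.

(** Removing [s] creates only the hole [s]. The old holes come no later than the Frobenius element
    of [S], which precedes [s]; the full cone has no old holes. *)
Lemma effective_son_max_hole S S' :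
  C_semigroup C S -> effective_sons le C S S' ->
  exists2 s, max_hole S' s & S = s |` S'.
Proof.
move=> cS [s [gen_s Fs] <-]; have [affS SC finS] := cS.
have [Ss _] := minimal_generator_irreducible gen_s.
have lehs h : holes C S h -> le h s.
  move=> hh; have [eSC|SnC] := pselect (S = lattice_points C).
    by case: hh => Ch; rewrite eSC.
  have [f maxf] := max_hole_exists cS SnC.
  have /precedes_le lefs := (Fb_precedesE s maxf).1 Fs.
  by case: le_monomial => -[_ _ trans _] _ _; apply: trans lefs; exact: maxf.2.
exists s; last by rewrite setDUK // => _ ->.
rewrite /max_hole holesD1 //; split; first by left.
move=> h [->|]; last exact: lehs.
by case: le_monomial => -[refl _ _ _] _ _; exact: refl.
Qed.

Lemma effective_son_inj S1 S2 S' : C_semigroup C S1 -> C_semigroup C S2 ->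
  effective_sons le C S1 S' -> effective_sons le C S2 S' -> S1 = S2.
Proof.
move=> c1 c2 /(effective_son_max_hole c1)[s max_s ->].
by move=> /(effective_son_max_hole c2)[t /(max_hole_unique max_s) -> ->].
Qed.

Lemma lattice_points_not_son S : C_semigroup C S ->
  ~ effective_sons le C S (lattice_points C).
Proof. by move=> cS /(effective_son_max_hole cS)[s [[]]]. Qed.

Lemma lattice_points_C_semigroup : C_semigroup C (lattice_points C).
Proof.
split=> //; first exact: lattice_points_affine.
by rewrite /holes setDv; exact: finite_set0.
Qed.

(** Were [f + x] a hole, maximality and antisymmetry would give [f + x = f], and cancellation
    [x = 0]. *)
Lemma max_hole_add S f x : submonoid S -> max_hole S f ->
  lattice_points C x -> x <> 0 -> S (f + x).
Proof.
case: le_monomial => -[_ anti _ _] leD le0 _ [[Cf NSf] maxf] Cx x0.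
apply: contrapT => NS; apply: x0.
have [_ CD] := lattice_points_submonoid coneC.
have lefx : le f (f + x) by have := leD _ _ f (le0 x); rewrite add0r addrC.
have lexf : le (f + x) f by apply: maxf; split=> //; exact: CD.
by apply: (@nat_rV_addrI _ f); rewrite addr0; apply: anti; rewrite lexf.
Qed.

Lemma C_semigroup_parent S f : C_semigroup C S -> max_hole S f ->
  C_semigroup C (f |` S) /\ effective_sons le C (f |` S) S.
Proof.
move=> cS maxf; have [affS SC finS] := cS; have [[Cf NSf] _] := maxf.
have monS := affine_submonoid affS.
have f0 : f <> 0 by move=> f0; apply: NSf; rewrite f0; exact: monS.1.
(* A sum involving [f] lands in [S] by [max_hole_add], unless the other summand is zero and the sum
   is [f]. *)
have monfS : submonoid (f |` S).
  split; first by right; exact: monS.1.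
  move=> x y [->|Sx] [->|Sy]; last by right; exact: monS.2.
  - by right; exact: max_hole_add.
  - have [->|/eqP y0] := eqVneq y 0; first by left; rewrite addr0.
    by right; apply: max_hole_add => //; exact: SC.
  - have [->|/eqP x0] := eqVneq x 0; first by left; rewrite add0r.
    by right; rewrite addrC; apply: max_hole_add => //; exact: SC.
have fSC : f |` S `<=` lattice_points C by move=> x [->|/SC].
have eS : (f |` S) `\ f = S.
  apply/seteqP; split=> [x [[->|//]]|x Sx]; first by case.
  by split; [right|move=> xf; apply: NSf; rewrite -xf].
have hfS h : holes C (f |` S) h -> holes C S h /\ h <> f.
  move=> [Ch Nh]; split; last by move=> hf; apply: Nh; left.
  by split=> // Sh; apply: Nh; right.
have cfS : C_semigroup C (f |` S).
  split=> //; first exact: affine_semigroupU1.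
  by apply: sub_finite_set finS => h /hfS[].
split=> //; exists f => //; split.
  apply: irreducible_minimal_generator => //; split; first by left.
  by rewrite eS.
(* If the parent is the full cone, its Frobenius element precedes everything by convention.
   Otherwise its largest hole is a hole of [S] other than [f], hence before [f]. *)
have [efC|nfC] := pselect (f |` S = lattice_points C).
  by left; rewrite /Frobenius asboolT.
have [g maxg] := max_hole_exists cfS nfC.
apply/(Fb_precedesE f maxg); have [hg gf] := hfS _ maxg.1.
by rewrite /precedes maxf.2 // andbT; apply/eqP.
Qed.

(** * Vertices and walks of the tree *)

Lemma vertices_C_semigroup : vertices le C = [set S | C_semigroup C S].
Proof.
apply/seteqP; split=> [S [i _]|S].
  elim: i S => [|i IHi] S /=.
    by move=> ->; exact: lattice_points_C_semigroup.
  by move=> [S0 /IHi cS0]; exact: effective_son_C_semigroup.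
move=> cS; have [_ _ /finite_seqP[s es]] := cS.
(* The measure is the length of a list of the holes, possibly with repetitions; filtering out [f]
   shortens it and lists the holes of the parent. *)
have [n] := ubnP (size s); elim: n S s cS es => // n IHn S s cS es.
rewrite ltnS => lesn.
have [->|SnC] := pselect (S = lattice_points C); first by exists 0%N.
have [f maxf] := max_hole_exists cS SnC.
have [cfS sonS] := C_semigroup_parent cS maxf.
have fs : f \in s by have := maxf.1; rewrite es.
have [] := IHn _ [seq x <- s | x != f] cfS.
- apply/seteqP; split=> x.
    move=> [Cx Nx]; have : holes C S x by split=> // Sx; apply: Nx; right.
    rewrite es /= mem_filter => -> ; rewrite andbT; apply/eqP => xf.
    by apply: Nx; left.
  rewrite /= mem_filter => /andP[/eqP xf xs].
  have [Cx NSx] : holes C S x by rewrite es.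
  by split=> // -[].
- rewrite size_filter; apply: leq_trans lesn.
  rewrite -(count_predC (pred1 f) s) -add1n leq_add2r.
  by rewrite -has_count has_pred1.
by move=> i _ levi; exists i.+1 => //; exists (f |` S).
Qed.

Lemma edge_C_semigroup S S' : edge le C S S' ->
  [/\ C_semigroup C S, C_semigroup C S' & effective_sons le C S S'].
Proof. by move=> /asboolP; rewrite vertices_C_semigroup. Qed.

(** Walks are compared from their ends: a common last vertex has only one parent, so the walks agree
    one step earlier. The root has no parent, so neither walk runs out first. *)
Lemma rooted_path_unique w1 w2 :
  path (edge le C) (lattice_points C) w1 ->
  path (edge le C) (lattice_points C) w2 ->
  last (lattice_points C) w1 = last (lattice_points C) w2 -> w1 = w2.
Proof.
elim/last_ind: w1 w2 => [|w1 S1 IH] w2; case/lastP: w2 => [|w2 S2] //.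
- rewrite rcons_path last_rcons => _ /andP[_ /edge_C_semigroup[c _ son]] e.
  by move: son; rewrite -e => /(lattice_points_not_son c).
- rewrite rcons_path last_rcons => /andP[_ /edge_C_semigroup[c _ son]] _ e.
  by move: son; rewrite e => /(lattice_points_not_son c).
rewrite !rcons_path !last_rcons => /andP[pw1 /edge_C_semigroup[c1 _ son1]].
move=> /andP[pw2 /edge_C_semigroup[c2 _ son2]] e; rewrite -e in son2 *.
by rewrite (IH w2) //; exact: effective_son_inj son2.
Qed.

Lemma rooted_tree_C_semigroups :
  rooted_tree (vertices le C) (edge le C) (lattice_points C).
Proof.
split; first by exists 0%N.
  by move=> S S' /asboolP[].
move=> S vS; suff [w pw ew] : exists2 w, path (edge le C) (lattice_points C) w
    & last (lattice_points C) w = S.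
  exists w; split=> // w' [pw' ew'].
  by apply: rooted_path_unique => //; rewrite ew ew'.
case: vS => i _; elim: i S => [|i IHi] S /=; first by move=> ->; exists [::].
move=> [S0 lev0 son]; have [w pw ew] := IHi _ lev0.
exists (rcons w S); last by rewrite last_rcons.
rewrite rcons_path pw ew; apply/asboolP; split=> //; first by exists i.
by exists i.+1 => //; exists S0.
Qed.

End Frobenius.

Theorem proposition4 (p : nat) (hp : (0 < p)%N)
    (C : set 'rV[rat]_p) (hC : rational_cone C)
    (le : rel 'rV[nat]_p) (hle : monomial_order le)
    (hfin : forall a : 'rV[nat]_p, finite_set [set b | precedes le b a]) :
  rooted_tree (vertices le C) (edge le C) (lattice_points C) /\
  vertices le C = [set S | C_semigroup C S].
Proof.
split; first exact: rooted_tree_C_semigroups.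
exact: vertices_C_semigroup.
Qed.
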